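(* Let $n\ge 1$. For any $a\in\{0,1,2,3,4\}$ and any $b\in\{0,1,\dots,2n\}$, the binary code \[\mathcal{C}_2(n)=\left\{\boldsymbol{x}\in\mathbb{Z}_2^n:\ r^{(1)}(\boldsymbol{x})\equiv a \pmod 5 \ \text{ and }\ \sum_{i=1}^{r(\boldsymbol{x})} i\,r_i(\boldsymbol{x})\equiv b \pmod{2n+1}\right\}\] is single palindromic duplication (length $2$) correcting.
   Context: For a word $\boldsymbol{x}$, a run is a maximal block of consecutive equal symbols; $r(\boldsymbol{x})$ is the number of runs, $r_i(\boldsymbol{x})$ the length of the $i$-th run (from left to right), and $r^{(1)}(\boldsymbol{x})$ the number of runs of length exactly $1$. A palindromic duplication of length $\ell$ at position $p$ ($0\le p\le|\boldsymbol{x}|-\ell$) in $\boldsymbol{x}=(\boldsymbol{u}\boldsymbol{v}\boldsymbol{w})$, $|\boldsymbol{u}|=p$, $|\boldsymbol{v}|=\ell$, yields $\rho_\ell(\boldsymbol{x},p)=(\boldsymbol{u}\boldsymbol{v}\boldsymbol{v}^{\mathrm R}\boldsymbol{w})$, where $\boldsymbol{v}^{\mathrm R}$ is the reversal of $\boldsymbol{v}$. The ball $B^{\rho_\ell}_1(\boldsymbol{x})$ consists of $\boldsymbol{x}$ itself and all words $\rho_\ell(\boldsymbol{x},p)$. A code $\mathcal{C}$ is single palindromic duplication (length $\ell$) correcting if for all $\boldsymbol{c}_1,\boldsymbol{c}_2\in\mathcal{C}$, $B^{\rho_\ell}_1(\boldsymbol{c}_1)\cap B^{\rho_\ell}_1(\boldsymbol{c}_2)\neq\emptyset$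 implies $\boldsymbol{c}_1=\boldsymbol{c}_2$. *)

(* Defs.v *)
From mathcomp Require Import all_boot zmodp.

Set Implicit Arguments.
Unset Strict Implicit.
Unset Printing Implicit Defensive.

Section Runs.

Variable T : eqType.
Implicit Types x y : seq T.

(* [runs s'] is empty only for the empty word and never contains an empty
   block (see [runs_neq_nil]), so the default branch means [s' = [::]]. *)
Fixpoint runs (s : seq T) : seq (seq T) :=
  if s is c :: s' then
    if runs s' is (d :: u) :: rs then
      if c == d then (c :: d :: u) :: rs else [:: c] :: (d :: u) :: rs
    else [:: [:: c]]
  else [::].

Lemma runs_cons c s : exists u rs, runs (c :: s) = (c :: u) :: rs.
Proof.
rewrite /=; case: (runs s) => [|[|d u] rs]; try by exists [::], [::].
case: eqP => [->|_]; first by exists (d :: u), rs.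
by exists [::], ((d :: u) :: rs).
Qed.

Lemma flatten_runs s : flatten (runs s) = s.
Proof.
elim: s => [|c [|d s] IHs] //.
have [u [rs def_rs]] := runs_cons d s.
rewrite -[runs (c :: _)]/(if runs (d :: s) is (d :: u) :: rs then
  if c == d then (c :: d :: u) :: rs else [:: c] :: (d :: u) :: rs
  else [:: [:: c]]) -[in RHS]IHs def_rs.
by case: eqP.
Qed.

Lemma runs_neq_nil s : [::] \notin runs s.
Proof.
elim: s => [|c s] //=; case: (runs s) => [|[|d u] rs] //= IHs.
by case: eqP.
Qed.

Lemma runs_constant s : all constant (runs s).
Proof.
elim: s => [|c s] //=; case: (runs s) => [|[|d u] rs] //= /andP[cu crs].
by case: eqP => [->|_] /=; rewrite ?eqxx cu crs.
Qed.

Lemma runs_maximal c0 s :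
  sorted (fun u v : seq T => last c0 u != head c0 v) (runs s).
Proof.
elim: s => [|c s] //=; case: (runs s) => [|[|d u] [|v rs]] //= IHs.
- by case: (c =P d) => [|/eqP neq_cd] //=; rewrite neq_cd.
- by case: (c =P d) => [|/eqP neq_cd] //=; rewrite neq_cd IHs.
Qed.

Definition num_runs x := size (runs x).

(* Runs are numbered from 1, as in the range [1 <= i <= num_runs x]. *)
Definition run_length x i := size (nth [::] (runs x) i.-1).

Definition num_runs1 x := count (fun u : seq T => size u == 1) (runs x).

End Runs.

Section PalindromicDuplication.

Variable T : Type.
Implicit Types x y : seq T.

Definition pal_dup l x p :=
  let v := take l (drop p x) in take p x ++ v ++ rev v ++ drop (p + l) x.

(* The range [0 <= p <= size x - l] is written [p + l <= size x], which is
   empty when [size x < l]; truncated subtraction would wrongly allow p = 0. *)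
Definition pal_dup_ball l x y : Prop :=
  y = x \/ exists2 p, p + l <= size x & y = pal_dup l x p.

End PalindromicDuplication.

Definition single_pal_dup_correcting (T : finType) n l (C : {set n.-tuple T}) :
    Prop :=
  forall c1 c2, c1 \in C -> c2 \in C ->
  (exists y, pal_dup_ball l c1 y /\ pal_dup_ball l c2 y) -> c1 = c2.

Definition code2 (n a b : nat) : {set n.-tuple 'Z_2} :=
  [set x : n.-tuple 'Z_2 | (num_runs1 x == a %[mod 5]) &&
           (\sum_(1 <= i < (num_runs x).+1) i * run_length x i
              == b %[mod 2 * n + 1])].

(* Main.v *)
Require Import Defs.
From mathcomp Require Import all_boot zmodp.
From mathcomp Require Import zify.

(** Write [y = u a b b a w] for a duplication of [x = u a b w] and let [k] be
    the index of the run of the first displayed [a]. The number of runs of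
    length 1 changes by [0] if [a = b] or [w] is empty, by [+1] or [+2] if
    [a != b] and [w] starts with [b], and by [-1] or [-2] if [a != b] and [w]
    starts with [a]; so its residue mod 5 separates these three situations.
    The weighted sum of the run lengths increases by [2k] if [a = b], by
    [2k + 3 + 2|w|] if [a != b] and [w] starts with [b], and by [2k + 3]
    otherwise. This increase lies in [[1, 2n+1]], hence is determined by its
    residue. Its parity separates [a = b] from [w] empty. If [a = b], it gives
    the run in which the duplication took place, hence [x]; if [w] is empty there
    is nothing to determine; otherwise it is strictly monotone in the position
    of the duplication, since [a b b a] occurs there in [y]. *)

Set Implicit Arguments.
Unset Strict Implicit.
Unset Printing Implicit Defensive.

(** * Runs of a concatenation and weighted sums of run lengths *)

Section RunStatistics.

Variable T : eqType.
Implicit Types (s t u w : seq T) (L : seq (seq T)) (a b c : T).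

(** The starting weight [k] is free, so that the recursion can pass to the tail and blocks can be
    shifted in rank. *)
Fixpoint rank_sum k L :=
  if L is u :: L' then k * size u + rank_sum k.+1 L' else 0.

Definition run_sum s := rank_sum 1 (runs s).

Lemma rank_sum_cat k L1 L2 :
  rank_sum k (L1 ++ L2) = rank_sum k L1 + rank_sum (k + size L1) L2.
Proof.
by elim: L1 k => [|u L1 IH] k /=; rewrite ?addn0 // IH addSnnS addnA.
Qed.

Lemma rank_sumD m k L :
  rank_sum (m + k) L = rank_sum k L + m * size (flatten L).
Proof.
elim: L k => [|u L IH] k /=; first by rewrite muln0.
by rewrite -addnS IH size_cat; lia.
Qed.

Lemma rank_sumE k L :
  rank_sum k.+1 L = \sum_(0 <= i < size L) (k + i).+1 * size (nth [::] L i).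
Proof.
elim: L k => [|u L IH] k /=; first by rewrite big_geq.
by rewrite big_nat_recl // IH addn0; under eq_bigr do rewrite addSnnS.
Qed.

Lemma run_sumE s :
  \sum_(1 <= i < (num_runs s).+1) i * run_length s i = run_sum s.
Proof. by rewrite big_add1 /= /run_sum rank_sumE. Qed.

Lemma runs_cons_eq c s u L :
  runs (c :: s) = (c :: u) :: L -> runs (c :: c :: s) = [:: c, c & u] :: L.
Proof. by move=> /= ->; rewrite eqxx. Qed.

Lemma runs_cons_neq c d s :
  c != d -> runs (c :: d :: s) = [:: c] :: runs (d :: s).
Proof.
have [u [L /= ->]] := runs_cons d s.
by case: eqP.
Qed.

(** [P] and [h] are chosen before [s]: a prefix acts in the same way on the runs of every
    continuation that starts with [a]. Hence the words before and after a duplication can be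
    compared through their tails alone. *)
Lemma runs_cat u a : exists P h, forall s g L,
  runs (a :: s) = (a :: g) :: L ->
  runs (u ++ a :: s) = P ++ (h ++ a :: g) :: L.
Proof.
elim: u => [|c u [P [h IH]]]; first by exists [::], [::].
case: P IH => [|v P] IH.
- case: h IH => [|d h] IH.
  + have [ca|ca] := eqVneq c a.
      by exists [::], [:: c] => s g L /IH /= ->; rewrite ca eqxx.
    exists [:: [:: c]], [::] => s g L /IH /= ->.
    by rewrite (negPf ca).
  + have [cd|cd] := eqVneq c d.
      by exists [::], [:: c, d & h] => s g L /IH /= ->; rewrite cd eqxx.
    exists [:: [:: c]], (d :: h) => s g L /IH /= ->.
    by rewrite (negPf cd).
- case: v IH => [|d v] IH.
    (* The continuation [[:: a]] serves as a test word showing that no block of [P] is empty. *)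
    by have := runs_neq_nil (u ++ [:: a]); rewrite (IH [::] [::] [::]).
  have [cd|cd] := eqVneq c d.
    by exists ([:: c, d & v] :: P), h => s g L /IH /= ->; rewrite cd eqxx.
  exists [:: [:: c], d :: v & P], h => s g L /IH /= ->.
  by rewrite (negPf cd).
Qed.

(** * Run index of a position, and the effect of one duplication *)

Lemma num_runs_rcons u a b :
  num_runs (rcons (rcons u a) b) = num_runs (rcons u a) + (a != b).
Proof.
have [P [h Ph]] := runs_cat u a.
rewrite -!cats1 -catA /num_runs (Ph [::] [::] [::]) //.
have [<-|ab] := eqVneq a b.
  have aa := @runs_cons_eq a [::] [::] [::] erefl.
  by rewrite (Ph _ _ _ aa) !size_cat addn0.
rewrite (Ph _ [::] [:: [:: b]]) ?runs_cons_neq // !size_cat.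
by rewrite /= -addnA.
Qed.

Lemma num_runs_le_size s : num_runs s <= size s.
Proof.
elim: s => // c s; rewrite /num_runs /=.
by case: (runs s) => [|[|d u] L] //=; case: eqP => _ /=; lia.
Qed.

(** For [i < size s], the rank, counted from 1, of the run containing position [i], counted from
    0. *)
Definition head_rank s i := num_runs (take i.+1 s).

Lemma head_rankS x0 s i : i.+1 < size s ->
  head_rank s i.+1 = head_rank s i + (nth x0 s i != nth x0 s i.+1).
Proof.
move=> lt_i; rewrite /head_rank (take_nth x0 lt_i).
by rewrite (take_nth x0 (ltnW lt_i)) num_runs_rcons.
Qed.

Lemma head_rank_bounds s i m : i + m < size s ->
  head_rank s i <= head_rank s (i + m) <= head_rank s i + m.
Proof.
case: s => // x0 s; elim: m => [|m IH] im; first by rewrite !addn0 leqnn.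
have := IH ltac:(lia); rewrite addnS (@head_rankS x0); last by lia.
by case: (_ != _); lia.
Qed.

(** Ranks never decrease, so equal ranks at both ends exclude any change of symbol in between. *)
Lemma head_rank_const x0 s i m : i + m < size s ->
  head_rank s (i + m) = head_rank s i ->
  forall k, k <= m -> nth x0 s (i + k) = nth x0 s i.
Proof.
elim: m => [|m IH] im; first by move=> _ [|//]; rewrite addn0.
have im' : i + m < size s by lia.
have := head_rank_bounds im'.
rewrite addnS (@head_rankS x0); last by lia.
case: eqP => [eqm|_ le_r eq_r]; last by move: le_r eq_r; rewrite addn1; lia.
rewrite addn0 => _ eq_r k; rewrite leq_eqVlt => /predU1P[->|lt_k].
  by rewrite addnS -eqm IH.
exact: IH.
Qed.


(* [k] is the number of the run in which the duplicated pair starts. *)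
Variant pal_dup2_spec x y k a b w : Prop :=
| PalDupEq of a = b & num_runs1 y = num_runs1 x &
    run_sum y = run_sum x + 2 * k
| PalDupEnd of a != b & w = [::] & num_runs1 y = num_runs1 x &
    run_sum y = run_sum x + (2 * k + 3)
| PalDupAlt of a != b & head a w = b &
    num_runs1 x < num_runs1 y <= num_runs1 x + 2 &
    run_sum y = run_sum x + (2 * k + 3 + 2 * size w)
| PalDupTurn of a != b & head b w = a &
    num_runs1 y < num_runs1 x <= num_runs1 y + 2 &
    run_sum y = run_sum x + (2 * k + 3).

Lemma pal_dup2P u a b w :
  (a != b -> all (mem [:: a; b]) w) ->
  pal_dup2_spec (u ++ [:: a, b & w]) (u ++ [:: a, b, b, a & w])
    (num_runs (rcons u a)) a b w.
Proof.
have [P [h Ph]] := runs_cat u a => abw.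
have -> : num_runs (rcons u a) = (size P).+1.
  by rewrite /num_runs -cats1 (Ph [::] [::] [::]) // size_cat addn1.
have [eq_ab|ab] := eqVneq a b.
  rewrite -{}eq_ab {b abw}; have [g [L E]] := runs_cons a w.
  have E2 := runs_cons_eq E.
  have E4 := runs_cons_eq (runs_cons_eq E2).
  apply: PalDupEq => //; rewrite /num_runs1 /run_sum;
    rewrite (Ph _ _ _ E2) (Ph _ _ _ E4).
    by rewrite !count_cat /= !size_cat /= !addnS.
  by rewrite !rank_sum_cat /= !size_cat /=; lia.
have ba : b != a by rewrite eq_sym.
case: w abw => [|d w] abw.
  have Ex : runs [:: a; b] = [:: [:: a]; [:: b]] by rewrite runs_cons_neq.
  have Ey : runs [:: a; b; b; a] = [:: [:: a]; [:: b; b]; [:: a]].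
    rewrite runs_cons_neq // (@runs_cons_eq _ _ [::] [:: [:: a]]) //.
    by rewrite runs_cons_neq.
  apply: PalDupEnd => //; rewrite /num_runs1 /run_sum;
    rewrite (Ph _ _ _ Ex) (Ph _ _ _ Ey).
    by rewrite !count_cat.
  by rewrite !rank_sum_cat /= !size_cat /=; lia.
have /= /andP[] := abw ab; rewrite !inE => /orP[]/eqP-> _.
- have [g [L E]] := runs_cons a w.
  have Ex : runs [:: a, b, a & w] = [:: [:: a], [:: b], a :: g & L].
    by rewrite !runs_cons_neq // E.
  have Ey : runs [:: a, b, b, a, a & w] = [:: [:: a], [:: b; b], [:: a, a & g] & L].
    rewrite runs_cons_neq // (@runs_cons_eq _ _ [::] ([:: a, a & g] :: L)) //.
    by rewrite runs_cons_neq // (runs_cons_eq E).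
  apply: PalDupTurn => //; rewrite /num_runs1 /run_sum;
    rewrite (Ph _ _ _ Ex) (Ph _ _ _ Ey).
    by rewrite !count_cat /= !size_cat /=; lia.
  by rewrite !rank_sum_cat /= !size_cat /=; lia.
- have [g [L E]] := runs_cons b w.
  have Ex : runs [:: a, b, b & w] = [:: [:: a], [:: b, b & g] & L].
    by rewrite runs_cons_neq // (runs_cons_eq E).
  have Ey : runs [:: a, b, b, a, b & w] = [:: [:: a], [:: b; b], [:: a], b :: g & L].
    rewrite runs_cons_neq // (@runs_cons_eq _ _ [::] [:: [:: a], b :: g & L]) //.
    by rewrite !runs_cons_neq // E.
  (* The runs in [L] move up by two ranks, so their total length enters the increase; with [b :: g]
     they make up [b :: w]. *)
  have : size (flatten (runs (b :: w))) = (size w).+1 by rewrite flatten_runs.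
  rewrite E /= size_cat => szw.
  apply: PalDupAlt => //; rewrite /num_runs1 /run_sum;
    rewrite (Ph _ _ _ Ex) (Ph _ _ _ Ey).
    by rewrite !count_cat /= !size_cat /=; lia.
  rewrite !rank_sum_cat /= (rank_sumD 2 (1 + size P).+2) !size_cat /=; lia.
Qed.

End RunStatistics.

(** * Duplications of length 2, read off the resulting word *)

Lemma pal_dup2_cat (T : Type) (x : seq T) p : p + 2 <= size x ->
  exists u a b w, [/\ size u = p, x = u ++ [:: a, b & w] &
    pal_dup 2 x p = u ++ [:: a, b, b, a & w]].
Proof.
move=> le_x.
have szp : size (take p x) = p by rewrite size_takel //; lia.
have : 2 <= size (drop p x) by rewrite size_drop; lia.
case Ew: (drop p x) => [|a [|b w]] // _.
exists (take p x), a, b, w; split => //.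
  by rewrite -Ew cat_take_drop.
by rewrite /pal_dup addnC -drop_drop Ew /= take0 drop0.
Qed.

(** [d] and [e] differ by a multiple of [m], while their distance is less than [m]. *)
Lemma modn_shift_inj m s t d e : 0 < d <= m -> 0 < e <= m ->
  s = t %[mod m] -> s + d = t + e -> d = e.
Proof.
move=> dm em st eq_de; wlog le_de : s t d e dm em st eq_de / d <= e.
  move=> W; have [le_de|/ltnW le_ed] := leqP d e; first exact: (W s t).
  by symmetry; apply: (W t s).
have : s == t %[mod m] by apply/eqP.
rewrite eqn_mod_dvd; last by lia.
have -> : s - t = e - d by lia.
move=> m_dvd; apply/eqP; rewrite eqn_leq le_de leqNgt; apply/negP => lt_de.
by have := dvdn_leq _ m_dvd; rewrite subn_gt0 lt_de => /(_ isT); lia.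
Qed.

Lemma Z2_mem2 (a b c : 'Z_2) : a != b -> c \in [:: a; b].
Proof. by case: a b c => [[|[|a]] // ?] [[|[|b]] // ?] [[|[|c]] // ?]. Qed.

(** All data are expressed through [y] and [p], so that two duplications with the same result can be
    compared inside [y]. *)
Lemma pal_dup2_facts (z : 'Z_2) x p (y := pal_dup 2 x p) : p + 2 <= size x ->
  [/\ size y = (size x).+2,
      nth z y p.+2 = nth z y p.+1,
      nth z y p.+3 = nth z y p,
      forall i, nth z x i = nth z y (if i < p.+2 then i else i.+2) &
      pal_dup2_spec x y (head_rank y p) (nth z y p) (nth z y p.+1)
        (drop (p + 4) y)].
Proof.
move=> /pal_dup2_cat[u [a [b [w [szu Ex Ey]]]]].
have nth_y i : nth z y (p + i) = nth z [:: a, b, b, a & w] i.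
  by rewrite /y Ey nth_cat szu ltnNge leq_addr addKn.
have drop_y : drop (p + 4) y = w.
  by rewrite addnC -drop_drop /y Ey drop_size_cat //= drop0.
have take_y : take p.+1 y = rcons u a.
  by rewrite /y Ey -cat_rcons take_size_cat // size_rcons szu.
have := (nth_y 0, nth_y 1, nth_y 2, nth_y 3).
rewrite addn0 addn1 addn2 addn3 => -[[[-> ->] ->] ->]; split => //.
- by rewrite /y Ey Ex !size_cat /= !addnS.
- move=> i; rewrite /y Ey Ex !nth_cat szu.
  have [lt_i|le_i] := ltnP i p.+2.
    case: ltnP => // le_i; case E: (i - p) => [|[|k]] //; lia.
  have [-> ->] : (i < p) = false /\ (i.+2 < p) = false by lia.
  have -> : i = p + (i - p.+2).+2 by lia.
  by rewrite -!addnS !addKn.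
rewrite drop_y /head_rank take_y /y Ey Ex; apply: pal_dup2P => ab.
by apply/allP => c _; apply: Z2_mem2.
Qed.

Lemma pal_dup2_inj n x1 x2 p1 p2 : size x1 = n -> size x2 = n ->
  p1 + 2 <= n -> p2 + 2 <= n -> pal_dup 2 x1 p1 = pal_dup 2 x2 p2 :> seq 'Z_2 ->
  num_runs1 x1 = num_runs1 x2 %[mod 5] ->
  run_sum x1 = run_sum x2 %[mod 2 * n + 1] -> x1 = x2.
Proof.
wlog le_p : x1 x2 p1 p2 / p1 <= p2.
  move=> W sz1 sz2 le1 le2 eq_y eq_N eq_S.
  have [le_p|/ltnW le_p] := leqP p1 p2; first exact: (W _ _ p1 p2).
  by symmetry; apply: (W _ _ p2 p1).
move=> sz1 sz2 le1 le2 eq_y eq_N eq_S.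
pose z : 'Z_2 := ord0.
have le1x : p1 + 2 <= size x1 by rewrite sz1.
have le2x : p2 + 2 <= size x2 by rewrite sz2.
have [szy y12 _ nth_x1 spec1] := pal_dup2_facts z le1x.
have [_ y22 y23 nth_x2 spec2] := pal_dup2_facts z le2x.
move: szy y12 nth_x1 spec1; rewrite {}eq_y.
set y := pal_dup 2 x2 p2 in y22 y23 nth_x2 spec2 *.
rewrite sz1 => szy y12 nth_x1 spec1.
(* This keeps every increase in range: with [k <= p + 1] and [|w| = n - p - 2], one has
   [2k + 3 + 2|w| <= 2n + 1]. *)
have rank_le p : p + 2 <= n -> 0 < head_rank y p <= p.+1.
  move=> le_n; have sz_t : size (take p.+1 y) = p.+1 by rewrite size_takel //; lia.
  have := num_runs_le_size (take p.+1 y); rewrite sz_t => ->; rewrite andbT.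
  rewrite /head_rank; case Et: (take p.+1 y) sz_t => [|c t] // _.
  by have [u [L Ec]] := runs_cons c t; rewrite /num_runs Ec.
have /rank_le rk1 := le1; have /rank_le rk2 := le2.
have szw p : size (drop (p + 4) y) = n - (p + 2) by rewrite size_drop szy; lia.
have eqS d1 d2 : run_sum y = run_sum x1 + d1 -> run_sum y = run_sum x2 + d2 ->
    0 < d1 <= 2 * n + 1 -> 0 < d2 <= 2 * n + 1 -> d1 = d2.
  move=> E1 E2 d1n d2n; apply: (modn_shift_inj d1n d2n eq_S).
  by rewrite -E1 -E2.
case: (ltngtP p1 p2) le_p => // [lt_p _|eq_p _]; last first.
  apply: (@eq_from_nth _ z) => [|i _]; first by rewrite sz1 sz2.
  by rewrite nth_x1 nth_x2 eq_p.
have : p1.+1 + (p2 - p1.+1) < size y by lia.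
move=> /head_rank_bounds; rewrite subnKC // => rk12.
have /(head_rankS z) rkS : p1.+1 < size y by lia.
have szw1 := szw p1; have szw2 := szw p2.
have len_w1 := szw p1; have len_w2 := szw p2.
(* The residues mod 5 leave six of the sixteen pairs: the four with equal kinds, and [PalDupEq]
   against [PalDupEnd] in both orders. *)
case: spec1 => [ab1 N1 S1|ab1 /(congr1 size)/= w1 N1 S1|ab1 _ N1 S1|ab1 _ N1 S1];
  case: spec2 => [ab2 N2 S2|ab2 /(congr1 size)/= w2 N2 S2|ab2 _ N2 S2|ab2 _ N2 S2];
  try (by exfalso; clear - eq_N N1 N2; lia); have eqD := eqS _ _ S1 S2.
(* Both duplications lie in one run: [y] is constant from [p1] to [p2], and the palindrome at [p2]
   extends this to [p2 + 3]. *)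
- have {}eqD : head_rank y p1 = head_rank y p2.
    by clear - eqD rk1 rk2 le1 le2; lia.
  have const1 i : p1 <= i <= p2 -> nth z y i = nth z y p1.
    have lt_y : p1 + (p2 - p1) < size y by clear - lt_p szy le2; lia.
    have := head_rank_const z lt_y; rewrite subnKC; last exact: ltnW.
    move=> /(_ (esym eqD)) nth_p1 /andP[le_i le_ip].
    by rewrite -(subnKC le_i) nth_p1 // leq_sub2r.
  have const2 i : p1 <= i <= p2.+3 -> nth z y i = nth z y p1.
    move=> /andP[le_i]; rewrite -(const1 p2) ?leqnn ?andbT; last exact: ltnW.
    rewrite leq_eqVlt => /predU1P[->|]; first by rewrite y23.
    rewrite ltnS leq_eqVlt => /predU1P[->|]; first by rewrite y22 ab2.
    rewrite ltnS leq_eqVlt => /predU1P[->|]; first by rewrite ab2.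
    by rewrite ltnS => le_ip; rewrite !const1 ?le_i ?(ltnW lt_p) /=.
  apply: (@eq_from_nth _ z) => [|i _]; first by rewrite sz1 sz2.
  (* Only indices from [p1 + 2] to [p2 + 1] are read differently, at [i + 2] and at [i], both inside
     the constant stretch. *)
  rewrite nth_x1 nth_x2; have [lt_i1|le_1i] := ltnP i p1.+2.
    by rewrite ifT //; apply: leq_trans lt_i1 _; rewrite !ltnS ltnW.
  have [lt_i2|//] := ltnP i p2.+2.
  by rewrite !const2 //; clear - le_1i lt_i2; lia.
(* An even increase cannot equal an odd one. *)
- by clear - eqD rk1 rk2 le1 le2; lia.
- by clear - eqD rk1 rk2 le1 le2; lia.
(* An empty [w] forces [p1 = n - 2], leaving no room for a larger [p2]. *)
- by clear - w1 len_w1 lt_p le2; lia.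
(* Equal increases force the rank to grow by one at each step from [p1] to [p2], but [y] repeats its
   symbol at [p1 + 1] and [p1 + 2]. If [p2 = p1 + 1], this repetition contradicts [ab2]. *)
- have [lt_p' | le_p'] := ltnP p1.+1 p2; last first.
    have eq_p : p2 = p1.+1 by apply/eqP; rewrite eqn_leq le_p'.
    by rewrite eq_p y12 eqxx in ab2.
  have : p1.+2 + (p2 - p1.+2) < size y by clear - lt_p' szy le2; lia.
  move=> /head_rank_bounds; rewrite subnKC // => rk12'.
  have /(head_rankS z) : p1.+2 < size y by clear - lt_p' szy le2; lia.
  rewrite y12 eqxx addn0 => rkSS; rewrite ab1 addn1 in rkS.
  move: eqD; rewrite len_w1 len_w2 => eqD.
  by clear - eqD rk1 rk2 rk12' rkSS rkS le1 le2 lt_p'; lia.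
(* Equal increases give equal ranks at [p1] and [p2], but the rank already grows from [p1] to
   [p1 + 1]. *)
- rewrite ab1 addn1 in rkS.
  by clear - eqD rk1 rk2 rkS rk12 le1 le2; lia.
Qed.

Theorem theorem2 (n a b : nat) (n_ge1 : 1 <= n) (a_le4 : a <= 4)
    (b_le2n : b <= 2 * n) :
  single_pal_dup_correcting 2 (code2 n a b).
Proof.
move=> c1 c2; rewrite !inE !run_sumE.
move=> /andP[/eqP N1 /eqP S1] /andP[/eqP N2 /eqP S2].
case=> y [y1 y2]; apply: val_inj => /=.
have size_dup p : p + 2 <= n -> forall c : n.-tuple 'Z_2,
    size (pal_dup 2 c p) = n.+2.
  by move=> le_p c; have [|-> _ _ _ _] := @pal_dup2_facts 0%R c p; rewrite size_tuple.
case: y1 y2 => [->|[p1 le1 ->]] [|[p2 le2]] //.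
- rewrite size_tuple in le2.
  by move=> /(congr1 size); rewrite size_dup // size_tuple; lia.
- rewrite size_tuple in le1.
  by move=> /(congr1 size); rewrite size_dup // size_tuple; lia.
move=> eq_y; rewrite size_tuple in le1; rewrite size_tuple in le2.
apply: (pal_dup2_inj (size_tuple c1) (size_tuple c2) le1 le2 eq_y).
- by rewrite N1 N2.
- by rewrite S1 S2.
Qed.
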